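(* Let $\ell_a:\mathbb{T}\to[0,\infty)$, $a\in\mathbb{A}$, be a non-negative loss function, and define $$\mathcal{R}(x,\Theta)=\inf_{a\in\mathbb{A}}\frac{\mathsf{\Pi}_x\ell_a-\ell_a(\hat\theta_x)}{L_a(x,\Theta)-\ell_a(\hat\theta_x)}\ \ge 0,$$ where $L_a(x,\Theta)$ is the local maximum loss and $\hat\theta_x$ is the maximum likelihood estimator of $\Theta$ (all defined in the context). Then $$\sup_{\theta}\mathsf{P}_\theta\{\mathcal{R}(X,\theta)\le\alpha\}\le\alpha\quad\text{for all }\alpha\in[0,1].$$ This also implies the simpler-but-weaker result $$\sup_{\theta}\mathsf{P}_\theta\Bigl\{\inf_{a\in\mathbb{A}}\frac{\mathsf{\Pi}_X\ell_a}{L_a(X,\theta)}\le\alpha\Bigr\}\le\alpha\quad\text{for all }\alpha\in[0,1].$$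
   Context: Setting: $\{\mathsf{P}_\theta:\theta\in\mathbb{T}\}$ is a statistical model, consisting of probability distributions supported on (subsets of) a sample space $\mathbb{X}$, with corresponding density/mass functions $p_\theta(x)$. The observable data is $X$, with $x$ a generic realization, and $\Theta\in\mathbb{T}$ denotes the unknown true parameter value, so that $X\sim\mathsf{P}_\Theta$; prior information about $\Theta$ is vacuous. $\mathsf{P}_\theta\{\cdots\}$ is the probability when $X\sim\mathsf{P}_\theta$. $\mathbb{A}$ is the set of possible actions, and $\ell_a(\theta)$ is the loss incurred by taking action $a\in\mathbb{A}$ when the state of nature is $\theta$. Relative likelihood: $R(x,\theta)=p_\theta(x)/\sup_{\vartheta}p_\vartheta(x)$, $\theta\in\mathbb{T}$, where the denominator is assumed finite for almost all $x$. The maximum likelihood estimator $\hat\theta_x$ is the maximizer of $\theta\mapsto p_\theta(x)$. Possibilistic inferential model (IM): its contour is $\pi_x(\theta)=\mathsf{P}_\theta\{R(X,\theta)\le R(x,\theta)\}$, $\theta\in\mathbb{T}$, and its possibility measure (upper probability) is $\mathsf{\Pi}_x(H)=\sup_{\theta\in H}\pi_x(\theta)$, $H\subseteq\mathbb{T}$. Upper expectation: for $f:\mathbb{T}\to[0,\infty)$, $\mathsf{\Pi}_xf$ denotes the Choquet integral of $f$ with respect to $\mathsf{\Pi}_x$, $$\mathsf{\Pi}_xf=\int_0^1\Bigl\{\sup_{\theta:\pi_x(\theta)>s}f(\theta)\Bigr\}\,ds,$$ whose existence is assumed for the loss functions considered. Local maximum loss: $L_a(x,\Theta)=\sup\{\ell_a(\theta):\pi_x(\theta)>\pi_x(\Theta)\}$;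 $L_a(x,\theta)$ and $\mathcal{R}(x,\theta)$ denote the same quantities with $\theta$ in place of $\Theta$. *)

(* Defs.v *)
From HB Require Import structures.
From mathcomp Require Import all_boot all_order all_algebra.
From mathcomp Require Import all_classical all_reals all_analysis.
From mathcomp Require Import measurable_realfun.

Set Implicit Arguments.
Unset Strict Implicit.
Unset Printing Implicit Defensive.

Import Order.TTheory GRing.Theory Num.Theory.
Import numFieldNormedType.Exports.

Local Open Scope classical_set_scope.
Local Open Scope ring_scope.
Local Open Scope ereal_scope.

Section possibilistic_im.
Context (R : realType) (d : measure_display) (X : measurableType d).
Context (T A : Type).
Implicit Types (P : T -> probability X R) (p : T -> X -> R).
Implicit Types (l : A -> T -> R) (x : X) (theta : T) (a : A).

Definition has_density (mu : {measure set X -> \bar R})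
    (Q : probability X R) (f : X -> R) : Prop :=
  [/\ measurable_fun setT f, forall x, (0 <= f x)%R
    & forall B, measurable B -> Q B = \int[mu]_(x in B) (f x)%:E].

Definition sup_likelihood p x : \bar R :=
  ereal_sup [set (p theta x)%:E | theta in setT].

(* Equal to 0 when the denominator is 0 or +oo; under the hypotheses of use,
   this happens only on a set of x that is null under the whole model. *)
Definition relative_likelihood p x theta : \bar R :=
  (p theta x)%:E / sup_likelihood p x.

Definition is_mle p x theta : Prop := forall vth, (p vth x <= p theta x)%R.

Definition contour P p x theta : \bar R :=
  P theta [set y | relative_likelihood p y theta <= relative_likelihood p x theta].

(* s ranges over the open interval because no theta has contour > 1, so that
   the supremum at s = 1 would be ereal_sup set0 = -oo. *)
Definition choquet P p x (f : T -> R) : \bar R :=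
  \int[lebesgue_measure]_(s in `]0%R, 1%R[)
    ereal_sup [set (f theta)%:E | theta in [set theta | s%:E < contour P p x theta]].

(* Equal to -oo when contour P p x theta is the maximal value of the contour. *)
Definition local_max_loss P p (l : A -> T -> R) a x theta : \bar R :=
  ereal_sup [set (l a vth)%:E |
    vth in [set vth | contour P p x theta < contour P p x vth]].

(* u / v with u / v = +oo if v <= 0. In both infima below, a nonpositive
   denominator occurs when no theta' is strictly more plausible than theta, or
   when the loss of a does not exceed its value at the MLE (resp. 0) at any such
   theta'; the action a then does not contribute to the infimum. The library's
   0 / 0 = 0 would make the validity bound false, e.g. for a constant loss,
   whereas any value of 0 / 0 in [1, +oo] gives the same events
   {infimum <= alpha} for alpha < 1. *)
Definition loss_ratio (u v : \bar R) : \bar R := if 0 < v then u / v else +oo.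

Definition mle_adjusted_ratio P p l (mle : X -> T) x theta : \bar R :=
  ereal_inf [set loss_ratio (choquet P p x (l a) - (l a (mle x))%:E)
                            (local_max_loss P p l a x theta - (l a (mle x))%:E)
            | a in setT].

Definition simple_ratio P p l x theta : \bar R :=
  ereal_inf [set loss_ratio (choquet P p x (l a)) (local_max_loss P p l a x theta)
            | a in setT].

End possibilistic_im.

(* Main.v *)
Require Import Defs.
From HB Require Import structures.
From mathcomp Require Import all_boot all_order all_algebra.
From mathcomp Require Import all_classical all_reals all_analysis.
From mathcomp Require Import measurable_realfun.

Set Implicit Arguments.
Unset Strict Implicit.
Unset Printing Implicit Defensive.

Import Order.TTheory GRing.Theory Num.Theory.
Import numFieldNormedType.Exports.

Local Open Scope classical_set_scope.
Local Open Scope ring_scope.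
Local Open Scope ereal_scope.

(** Both bounds reduce to the validity of the contour: if Z = R(X, theta), then
    pi_X(theta) is the distribution function of Z evaluated at Z itself, hence
    is stochastically no smaller than a uniform variable
    ([mu_ext_cdf_le]).  It therefore suffices to show that, for almost every
    x, each ratio at (x, theta) is at least pi_x(theta); the event
    {ratio <= alpha} is then, up to a null set, part of
    {pi_x(theta) <= alpha}.

    This comparison is a bound on the Choquet integral.  Fix an action a, write
    c = pi_x(theta), let L be its local maximum loss, and take
    0 <= b <= l_a(mle x) with b <= L.  The mle has contour 1
    ([contour_mle]), so it belongs to {pi_x > s} for every s < 1, and the
    integrand sup {l_a : pi_x > s} is at least l_a(mle x) >= b throughout
    ]0, 1[.  When s < c, the set {pi_x > s} contains {pi_x > c}, and the
    integrand is at least L.  Integrating ([integral01_ge]),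
      Pi_x l_a >= b + c (L - b),
    that is, (Pi_x l_a - b) / (L - b) >= c whenever L > b
    ([contour_le_loss_ratio]).  The choice b = l_a(mle x) gives the adjusted
    ratio, and b = 0 the simple one. *)

(** The integral of a nonnegative function is a supremum over the simple
    functions below it, so monotonicity holds without measurability.  This is
    applied to the Choquet integrand, which dominates a two-step function. *)
Lemma ge0_le_integral_nonmeasurable d (X : measurableType d) (R : realType)
    (mu : {measure set X -> \bar R}) (D : set X) (f g : X -> \bar R) :
  (forall x, D x -> 0 <= f x) -> (forall x, D x -> f x <= g x) ->
  \int[mu]_(x in D) f x <= \int[mu]_(x in D) g x.
Proof.
move=> f0 fg.
have g0 x : D x -> 0 <= g x by move=> Dx; exact: le_trans (f0 _ Dx) (fg _ Dx).
rewrite !ge0_integralE//; apply: ereal_sup_le => _ [h hf <-]; exists h => //= x.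
apply: (le_trans (hf x)); rewrite /patch; case: ifPn => //.
by rewrite inE; exact: fg.
Qed.

(** The integrand is at least [b] on ]0, 1[ and gains a further [L - b] on
    ]0, c[. *)
Lemma integral01_ge (R : realType) (g : R -> \bar R) (c b : R) (L : \bar R) :
  (0 <= c <= 1)%R -> (0 <= b)%R -> b%:E <= L ->
  (forall s : R, (0 < s < 1)%R -> b%:E <= g s) ->
  (forall s : R, (0 < s < c)%R -> L <= g s) ->
  b%:E + c%:E * (L - b%:E) <= \int[lebesgue_measure]_(s in `]0%R, 1%R[) g s.
Proof.
move=> /andP[c0 c1] b0 bL gb gL.
have L0 : 0 <= L - b%:E by rewrite sube_ge0.
pose h : R -> \bar R := (cst (L - b%:E)) \_ `]0%R, c[.
have h0 s : 0 <= h s by rewrite /h patchE; case: ifP.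
have mh : measurable_fun setT h.
  by apply/(measurable_restrictT _ _).1 => //; exact: measurable_cst.
have step : \int[lebesgue_measure]_(s in `]0%R, 1%R[) (b%:E + h s) =
    b%:E + c%:E * (L - b%:E).
  rewrite ge0_integralD//=; last exact: measurable_funTS.
  rewrite integral_cst//= lebesgue_measure_itv/= lte01 sube0 mule1.
  rewrite -integral_mkcondr setIidr; last first.
    by apply: subset_itvl; rewrite bnd_simp.
  rewrite integral_cst//= lebesgue_measure_itv/= lte_fin muleC.
  by case: ltgtP c0 => // [c0|<-] _; rewrite ?sube0// mul0e.
rewrite -step; apply: ge0_le_integral_nonmeasurable => s /=; rewrite in_itv/=.
  by move=> _; rewrite adde_ge0// lee_fin.
move=> s01; rewrite /h patchE; case: ifPn; last by rewrite adde0 gb.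
by rewrite inE/= in_itv/= => sc; rewrite EFinN addeC subeK// gL.
Qed.

(** With F the distribution function of [Z], the values z such that
    F z <= alpha have a supremum s.  If s is such a value, the event is part of
    {Z <= s}, of probability F s <= alpha.  Otherwise the event is part of
    {Z < s}, an increasing union of events {Z <= v n} with F (v n) <= alpha. *)
Lemma mu_ext_cdf_le d (X : measurableType d) (R : realType)
    (Q : probability X R) (Z : X -> \bar R) (alpha : \bar R) :
  measurable_fun setT Z -> 0 <= alpha ->
  (Q^*)%mu [set x | Q [set y | Z y <= Z x] <= alpha] <= alpha.
Proof.
move=> mZ alpha0.
have mle z : measurable [set y | Z y <= z].
  by rewrite -[X in measurable X]setTI; exact: emeasurable_fun_infty_c.
set S : set (\bar R) := [set z | Q [set y | Z y <= z] <= alpha].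
have [S0|/set0P SN0] := eqVneq S set0.
  rewrite (_ : [set x | _] = set0) ?mu_ext0//.
  rewrite -subset0 => x Sx; suff : S (Z x) by rewrite S0.
  exact: Sx.
have [Sc|NSc] := pselect (S (ereal_sup S)).
  apply: le_trans Sc; rewrite -(measurable_mu_extE Q (mle _)).
  by apply: le_mu_ext => x Sx; apply: ereal_sup_ubound; exact: Sx.
have [u Su cvg_u] := ereal_sup_seq (proj2 (set0P S) SN0).
(* The running maximum of u makes the events {Z <= v n} increase with n, and it
   stays in S because it is one of the values of u. *)
pose v := fix v n := if n is k.+1 then maxe (v k) (u k) else u 0%N.
have Sv n : S (v n).
  by elim: n => //= n Sv; rewrite /maxe; case: ifP.
have nd_v : nondecreasing_seq (fun n => [set y | Z y <= v n]).
  apply/nondecreasing_seqP => n; rewrite subsetEset => y /= Zy.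
  by apply: (le_trans Zy); rewrite le_max lexx.
have mU : measurable (\bigcup_n [set y | Z y <= v n]).
  exact: bigcupT_measurable.
have cvg_Q := nondecreasing_cvg_mu (mu := Q) (fun n => mle (v n)) mU nd_v.
apply: (@le_trans _ _ (Q (\bigcup_n [set y | Z y <= v n]))).
  rewrite -(measurable_mu_extE Q mU); apply: le_mu_ext => x Sx.
  have SZx : S (Z x) by exact: Sx.
  have Zs : Z x < ereal_sup S.
    rewrite lt_neqAle ereal_sup_ubound ?andbT//.
    by apply/eqP => Zs; apply: NSc; rewrite -Zs.
  have [_ [n _ <-] Zu] : exists2 y, range u y & Z x < y.
    apply/ereal_sup_gt; apply: (lt_le_trans Zs).
    have <- := cvg_lim (@ereal_hausdorff R) cvg_u.
    apply: lime_le; first by apply/cvg_ex; exists (ereal_sup S).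
    by apply: nearW => n; apply: ereal_sup_ubound; exists n.
  exists n.+1 => //=; apply: (le_trans (ltW Zu)).
  by rewrite le_max lexx orbT.
rewrite -(cvg_lim (@ereal_hausdorff R) cvg_Q); apply: lime_le.
  by apply/cvg_ex; exists (Q (\bigcup_n [set y | Z y <= v n])).
by apply: nearW => n; exact: Sv.
Qed.

(** A density vanishes only on a null set of its own distribution; this excludes
    the sample points with zero supremum likelihood, where the relative
    likelihood degenerates. *)
Lemma ae_density_gt0 d (X : measurableType d) (R : realType)
    (mu : {measure set X -> \bar R}) (Q : probability X R) (f : X -> R) :
  has_density mu Q f -> {ae Q, forall x, (0 < f x)%R}.
Proof.
move=> [mf f0 QE].
have mf0 : measurable (f @^-1` [set 0%R]).
  by rewrite -[X in measurable X]setTI; exact: mf.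
exists (f @^-1` [set 0%R]); split => //.
- by rewrite QE// (eq_integral (cst 0)) ?integral0// => x; rewrite inE/= => ->.
- move=> x /= /negP; rewrite -leNgt => fx0.
  by apply/le_anti; rewrite fx0 f0.
Qed.

(** An infinite denominator makes the ratio 0, which is consistent because the
    finiteness of [u] then forces [c = 0]. *)
Lemma le_loss_ratio (R : realType) (c : R) (u v : \bar R) :
  (0 <= c)%R -> u < +oo -> c%:E * v <= u -> c%:E <= loss_ratio u v.
Proof.
move=> c0 uoo cvu; rewrite /loss_ratio; case: ifPn => [v0|_]; last exact: leey.
case: v => [v| |]// in cvu v0 *.
  by rewrite inver gt_eqF// lee_pdivlMr.
rewrite invey mule0 lee_fin leNgt; apply/negP => c_gt0.
by move: cvu; rewrite gt0_muley ?lte_fin// leye_eq => /eqP uE; rewrite uE in uoo.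
Qed.

(** The likelihood is one of those in the supremum; when that supremum is 0 or
    +oo, the quotient is 0. *)
Lemma relative_likelihood_le1 (R : realType) (d : measure_display)
    (X : measurableType d) (T : Type) (p : T -> X -> R) x theta :
  (0 <= p theta x)%R -> relative_likelihood p x theta <= 1.
Proof.
move=> p0; rewrite /relative_likelihood.
have : (p theta x)%:E <= sup_likelihood p x.
  by apply: ereal_sup_ubound; exists theta.
case: (sup_likelihood p x) => [s| |] //; last by rewrite invey mule0.
rewrite lee_fin inver; case: eqP => [->|/eqP s0 ps].
  move=> pe0; have -> : p theta x = 0%R by apply/le_anti; rewrite p0 pe0.
  by rewrite mul0e.
rewrite -EFinM lee_fin ler_pdivrMr ?mul1r//.
by rewrite lt_neqAle eq_sym s0 (le_trans p0).
Qed.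

Section validity.
Context (R : realType) (d : measure_display) (X : measurableType d) (T A : Type).
Variables (P : T -> probability X R) (p : T -> X -> R) (l : A -> T -> R).
Hypothesis mR : forall theta,
  measurable_fun setT ((relative_likelihood p)^~ theta : X -> \bar R).

Let measurable_contour_event theta (z : \bar R) :
  measurable [set y | relative_likelihood p y theta <= z].
Proof. by rewrite -[X in measurable X]setTI; exact: emeasurable_fun_infty_c. Qed.

Lemma contour_fin_num x theta : contour P p x theta \is a fin_num.
Proof. exact/fin_num_measure/measurable_contour_event. Qed.

Lemma contour_le1 x theta : contour P p x theta <= 1.
Proof. exact/probability_le1/measurable_contour_event. Qed.

(** At a maximizer with positive likelihood the relative likelihood is 1, its
    largest possible value, and the event defining the contour is certain. *)
Lemma contour_mle x m theta : (forall y, (0 <= p m y)%R) ->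
  (0 < p theta x)%R -> is_mle p x m -> contour P p x m = 1.
Proof.
move=> p0 ptheta pmle; have pm : (0 < p m x)%R := lt_le_trans ptheta (pmle _).
have supE : sup_likelihood p x = (p m x)%:E.
  apply/le_anti/andP; split; last by apply: ereal_sup_ubound; exists m.
  by apply: ge_ereal_sup => _ [w _ <-]; rewrite lee_fin.
rewrite /contour (_ : [set y | _] = setT) ?probability_setT//.
apply/seteqP; split => // y _ /=.
rewrite [leRHS]/relative_likelihood supE inver gt_eqF// -EFinM divff ?gt_eqF//.
exact: relative_likelihood_le1.
Qed.

(** The offset [b] covers both ratios at once: [l a m], with [m] the mle, for the
    adjusted one and 0 for the simple one. *)
Lemma contour_le_loss_ratio a x theta m (b : R) :
  contour P p x m = 1 -> (0 <= b <= l a m)%R ->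
  choquet P p x (l a) \is a fin_num ->
  contour P p x theta <=
    loss_ratio (choquet P p x (l a) - b%:E)
               (local_max_loss P p l a x theta - b%:E).
Proof.
move=> pim /andP[b0 bl] Cfin.
have pi0 : 0 <= contour P p x theta by exact: measure_ge0.
have pi1 := contour_le1 x theta.
have pifin := contour_fin_num x theta.
rewrite -(fineK pifin) !lee_fin in pi0 pi1 *.
have [bL|Lb] := leP b%:E (local_max_loss P p l a x theta); last first.
  rewrite /loss_ratio ifF ?leey//; apply/negbTE; rewrite -leNgt.
  by rewrite leeBlDr// add0e ltW.
apply: le_loss_ratio => //; first by rewrite ltey_eq fin_numB Cfin.
rewrite leeBrDl//; apply: integral01_ge; rewrite ?pi0//.
- move=> s /andP[_ s1]; apply: le_ereal_sup_tmp; exists (l a m)%:E => //.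
  by exists m => //=; rewrite pim lte_fin.
- move=> s /andP[_ sc]; apply: ereal_sup_le => _ [w /= pw <-]; exists w => //=.
  by apply: lt_trans pw; rewrite -(fineK pifin) lte_fin.
Qed.

(** Validity passes from the contour to any statistic dominating it almost
    surely, measurable or not: the exceptional null set is absorbed by the
    subadditivity of the outer probability. *)
Lemma mu_ext_le_of_ae_ge_contour theta (r : X -> \bar R) (alpha : R) :
  (0 <= alpha)%R -> {ae P theta, forall x, contour P p x theta <= r x} ->
  ((P theta)^*)%mu [set x | r x <= alpha%:E] <= alpha%:E.
Proof.
move=> alpha0 [N [mN PN0 cN]].
have le_cdf := mu_ext_cdf_le (P theta) (mR theta) (alpha0 : 0 <= alpha%:E).
set E := [set x | contour P p x theta <= alpha%:E].
apply: (@le_trans _ _ (((P theta)^*)%mu (E `|` N))).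
  apply: le_mu_ext => x /= rx.
  have [?|nx] := leP (contour P p x theta) (r x).
    by left; apply: le_trans rx.
  by right; apply: cN => /=; apply/negP; rewrite -ltNge.
apply: (le_trans (outer_measureU2 _ _ _)).
have N0 : ((P theta)^*)%mu N = 0 := etrans (measurable_mu_extE (P theta) mN) PN0.
by rewrite [X in _ + X]N0 adde0.
Qed.

End validity.

(** * Validity of the risk assessments *)
(* The two events involve an infimum over an arbitrary action space and need not
   be measurable: their probability is the outer probability (P theta)^*, which
   is P theta on measurable sets. *)
Theorem theorem1 (R : realType) (d : measure_display) (X : measurableType d)
    (T A : Type) (mu : {measure set X -> \bar R})
    (P : T -> probability X R) (p : T -> X -> R)
    (l : A -> T -> R) (mle : X -> T)
    (hp : forall theta, has_density mu (P theta) (p theta))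
    (hR : forall theta,
       measurable_fun setT ((relative_likelihood p)^~ theta : X -> \bar R))
    (hsup : forall theta, {ae P theta, forall x, sup_likelihood p x < +oo})
    (hmle : forall theta, {ae P theta, forall x, is_mle p x (mle x)})
    (hl : forall a theta, (0 <= l a theta)%R)
    (hchoquet : forall theta, {ae P theta, forall x, forall a,
       choquet P p x (l a) \is a fin_num}) :
  [/\ forall theta, {ae P theta, forall x, forall vth,
        0 <= mle_adjusted_ratio P p l mle x vth},
      forall alpha : R, (0 <= alpha <= 1)%R ->
        ereal_sup [set ((P theta)^*)%mu
                         [set x | mle_adjusted_ratio P p l mle x theta <= alpha%:E]
                  | theta in setT] <= alpha%:E
    & forall alpha : R, (0 <= alpha <= 1)%R ->
        ereal_sup [set ((P theta)^*)%mu
                         [set x | simple_ratio P p l x theta <= alpha%:E]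
                  | theta in setT] <= alpha%:E].
Proof.
have ae_regular theta : {ae P theta, forall x, contour P p x (mle x) = 1 /\
    forall a, choquet P p x (l a) \is a fin_num}.
  move: (ae_density_gt0 (hp theta)) (hmle theta) (hchoquet theta).
  apply: filterS3 => x pgt0 xmle xfin; split => //.
  by apply: contour_mle pgt0 xmle => y; have [] := hp (mle x).
have ae_adjusted theta : {ae P theta, forall x, forall vth,
    contour P p x vth <= mle_adjusted_ratio P p l mle x vth}.
  apply: filterS (ae_regular theta) => x [pi1 xfin] vth.
  apply: le_ereal_inf_tmp => _ [a _ <-].
  by apply: (contour_le_loss_ratio hR _ pi1) => //; rewrite hl lexx.
have ae_simple theta : {ae P theta, forall x,
    contour P p x theta <= simple_ratio P p l x theta}.
  apply: filterS (ae_regular theta) => x [pi1 xfin].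
  apply: le_ereal_inf_tmp => _ [a _ <-].
  rewrite -(sube0 (choquet _ _ _ _)) -(sube0 (local_max_loss _ _ _ _ _ _)).
  by apply: (contour_le_loss_ratio hR _ pi1) => //; rewrite lexx hl.
split.
- move=> theta; apply: filterS (ae_adjusted theta) => x pi_le vth.
  by apply: le_trans (pi_le vth); exact: measure_ge0.
- move=> alpha /andP[alpha0 _]; apply: ge_ereal_sup => _ [theta _ <-].
  apply: mu_ext_le_of_ae_ge_contour => //.
  by apply: filterS (ae_adjusted theta) => x; apply.
- move=> alpha /andP[alpha0 _]; apply: ge_ereal_sup => _ [theta _ <-].
  exact: mu_ext_le_of_ae_ge_contour.
Qed.
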